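(* Let $T$ be a tree with order $p$ and diameter $d \ge 2$, and let $\varepsilon = \varepsilon(T)$. Then $$\mathrm{rn}(T) = (p-1)(d+\varepsilon) - 2L(T) + \varepsilon$$ holds if and only if there exists a linear order $u_0, u_1, \ldots, u_{p-1}$ of the vertices of $T$ such that (a) $u_0 = w$ and $u_{p-1}$ is a neighbour of $w$ when $W(T) = \{w\}$, and $\{u_0, u_{p-1}\} = \{w, w'\}$ when $W(T) = \{w, w'\}$; (b) for all $0 \le i < j \le p-1$, $$d(u_i,u_j) \ge \sum_{t=i}^{j-1} \big(L(u_t) + L(u_{t+1})\big) - (j-i)(d+\varepsilon) + (d+1).$$ Moreover, under this condition the mapping $f$ defined by $f(u_0) = 0$ and $f(u_{i+1}) = f(u_i) - L(u_{i+1}) - L(u_i) + (d+\varepsilon)$ for $0 \le i \le p-2$ is an optimal radio labeling of $T$ (i.e. a radio labeling with span $\mathrm{rn}(T)$).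
   Context: For a connected graph $G$ with diameter $\mathrm{diam}(G)$ and distance $d(u,v)$, a radio labeling is a map $f: V(G) \to \{0,1,2,\ldots\}$ with $d(u,v) + |f(u)-f(v)| \ge \mathrm{diam}(G)+1$ for all distinct $u,v$; its span is $\max\{|f(u)-f(v)| : u,v \in V(G)\}$, and the radio number $\mathrm{rn}(G)$ is the minimum span over all radio labelings. For a tree $T$ and $v \in V(T)$, let $w_T(v) = \sum_{u \in V(T)} d(u,v)$; a weight centre of $T$ is a vertex minimizing $w_T$, and $W(T)$ denotes the set of weight centres. Every tree has either one weight centre or two weight centres, and in the latter case they are adjacent. Define $\varepsilon(T) = 1$ if $T$ has exactly one weight centre and $\varepsilon(T) = 0$ if it has two. The level of $u$ is $L(u) = \min\{d(u,x) : x \in W(T)\}$, and the total level is $L(T) = \sum_{u \in V(T)} L(u)$. *)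

(* Defs.v *)
From HB Require Import structures.
From mathcomp Require Import all_boot all_order all_algebra.
From mathcomp Require Import boolp.

Set Implicit Arguments.
Unset Strict Implicit.
Unset Printing Implicit Defensive.

Import Order.TTheory GRing.Theory Num.Theory.

(* A simple graph is a symmetric irreflexive relation on a finType of
   vertices; [ucycle e c] with [2 < size c] is a cycle of the graph. *)
Definition is_tree (T : finType) (e : rel T) : Prop :=
  [/\ 0 < #|T|, symmetric e, irreflexive e,
      forall x y, connect e x y
    & forall c : seq T, ucycle e c -> size c <= 2].

Definition walk_of_length (T : finType) (e : rel T) (x y : T) (n : nat) : bool :=
  [exists p : n.-tuple T, path e x p && (last x p == y)].

(* In a connected graph every distance is < #|T|; [find] returns the least
   length of a walk, with the junk value #|T| for disconnected vertices. *)
Definition dist (T : finType) (e : rel T) (x y : T) : nat :=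
  find (walk_of_length e x y) (iota 0 #|T|).

Definition diam (T : finType) (e : rel T) : nat :=
  \max_(x : T) \max_(y : T) dist e x y.

Definition radio_labeling (T : finType) (e : rel T) (f : T -> nat) : Prop :=
  forall u v : T, u != v ->
    (diam e).+1 <= dist e u v + `|((f u)%:Z - (f v)%:Z)%R|%N.

Definition label_span (T : finType) (f : T -> nat) : nat :=
  \max_(u : T) \max_(v : T) `|((f u)%:Z - (f v)%:Z)%R|%N.

Definition is_radio_span (T : finType) (e : rel T) (n : nat) : bool :=
  `[< exists2 f : T -> nat, radio_labeling e f & label_span f = n >].

Lemma radio_span_exists (T : finType) (e : rel T) : exists n, is_radio_span e n.
Proof.
pose f (u : T) := (diam e).+1 * enum_rank u.
exists (label_span f); apply/asboolP; exists f => // u v neq_uv.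
apply: leq_trans (leq_addl _ _).
rewrite /f !PoszM -mulrBr abszM absz_nat leq_pmulr // lt0n absz_eq0 subr_eq0.
by apply: contra neq_uv => /eqP[/val_inj/enum_rank_inj->].
Qed.

Definition rn (T : finType) (e : rel T) : nat := ex_minn (radio_span_exists e).

Definition optimal_radio_labeling (T : finType) (e : rel T) (f : T -> nat) : Prop :=
  radio_labeling e f /\ label_span f = rn e.

Definition weight (T : finType) (e : rel T) (v : T) : nat :=
  \sum_(u : T) dist e u v.

Definition weight_centres (T : finType) (e : rel T) : {set T} :=
  [set v | [forall u, weight e v <= weight e u]].

Definition eps (T : finType) (e : rel T) : nat := #|weight_centres e| == 1.

(* [dist] is bounded by #|T| and [weight_centres e] is nonempty, so the
   default value #|T| never affects the minimum. *)
Definition level (T : finType) (e : rel T) (u : T) : nat :=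
  \big[minn/#|T|]_(x in weight_centres e) dist e u x.

Definition total_level (T : finType) (e : rel T) : nat :=
  \sum_(u : T) level e u.

(* A linear order u_0, ..., u_(p-1) of the p = #|T| vertices is given by the
   values of [u : nat -> T] on [0, p); the other values are irrelevant. *)
Definition vertex_order (T : finType) (u : nat -> T) : Prop :=
  (forall i j, i < #|T| -> j < #|T| -> u i = u j -> i = j) /\
  (forall v : T, exists2 i, i < #|T| & u i = v).

Definition endpoints_cond (T : finType) (e : rel T) (u : nat -> T) : Prop :=
  (forall w, weight_centres e = [set w] -> u 0 = w /\ e w (u #|T|.-1)) /\
  (forall w w', w != w' -> weight_centres e = [set w; w'] ->
     [set u 0; u #|T|.-1] = [set w; w']).

Local Open Scope ring_scope.

Definition distance_cond (T : finType) (e : rel T) (u : nat -> T) : Prop :=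
  forall i j : nat, (i < j)%N -> (j < #|T|)%N ->
    (dist e (u i) (u j))%:Z >=
      \sum_(i <= t < j) ((level e (u t))%:Z + (level e (u t.+1))%:Z)
      - (j%:Z - i%:Z) * ((diam e)%:Z + (eps e)%:Z) + ((diam e)%:Z + 1).

Fixpoint label_seq (T : finType) (e : rel T) (u : nat -> T) (i : nat) : int :=
  if i is k.+1 then
    label_seq e u k - (level e (u k.+1))%:Z - (level e (u k))%:Z
    + ((diam e)%:Z + (eps e)%:Z)
  else 0.

(* Main.v *)
(** On a tree the weight is strictly convex along paths, so two distinct weight
    centres are adjacent and [d(u,v) + eps <= L(u) + L(v) + 1] always holds.
    If the vertices are sorted by a radio labeling, each increment is therefore at
    least [d + eps - L(u_i) - L(u_(i+1))], and summing gives a span of at least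
    [(p-1)(d+eps) - 2 L(T) + L(u_0) + L(u_(p-1))], where the last two terms
    together are at least [eps]. The bound is attained exactly when every
    increment is minimal, i.e. the labeling is [label_seq] up to a constant, and
    [L(u_0) + L(u_(p-1)) = eps]; for such a labeling the radio condition is (b). *)

Require Import Defs.
From HB Require Import structures.
From mathcomp Require Import all_boot all_order all_algebra.
From mathcomp Require Import boolp zify.

Set Implicit Arguments.
Unset Strict Implicit.
Unset Printing Implicit Defensive.

Import Order.TTheory GRing.Theory Num.Theory.

(** * Distances and geodesics in a finite graph *)

Lemma dist_le_card (T : finType) (e : rel T) (x y : T) : dist e x y <= #|T|.
Proof. by rewrite -[leqRHS](size_iota 0); apply: find_size. Qed.

Lemma dist_le_path (T : finType) (e : rel T) (x y : T) (p : seq T) :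
  path e x p -> last x p = y -> dist e x y <= size p.
Proof.
move=> ep lp; rewrite leqNgt; apply/negP => lt_p.
have lt_pT : size p < #|T| := leq_trans lt_p (dist_le_card e x y).
have /negbT/negP[] := before_find 0 lt_p.
rewrite nth_iota // add0n /walk_of_length; apply/existsP; exists (in_tuple p).
by rewrite ep lp eqxx.
Qed.

(** Shortening a walk until its vertices are distinct brings its length below [#|T|], so the search
    that defines [dist] succeeds and does not return its default value. *)
Lemma connect_geodesic (T : finType) (e : rel T) (x y : T) : connect e x y ->
  exists2 p, path e x p /\ last x p = y & size p = dist e x y.
Proof.
case/connectP=> p0 ep0 ->; case/shortenP: ep0 => p ep up _.
have lt_pT : size p < #|T| by have := card_uniqP up => /= <-; apply: max_card.
have hasw : has (walk_of_length e x (last x p)) (iota 0 #|T|).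
  apply/hasP; exists (size p); first by rewrite mem_iota.
  by rewrite /walk_of_length; apply/existsP; exists (in_tuple p); rewrite ep eqxx.
have := nth_find 0 hasw; rewrite has_find size_iota in hasw.
rewrite nth_iota // add0n /walk_of_length => /existsP[q /andP[eq /eqP lq]].
by exists q => //; rewrite size_tuple.
Qed.

Lemma distxx (T : finType) (e : rel T) (x : T) : dist e x x = 0.
Proof. by apply/eqP; rewrite -leqn0 (@dist_le_path _ _ _ _ [::]). Qed.

Lemma dist_edge (T : finType) (e : rel T) (x y : T) : e x y -> dist e x y <= 1.
Proof. by move=> exy; apply: (@dist_le_path _ _ _ _ [:: y]) => //=; rewrite exy. Qed.

Lemma dist_eq0 (T : finType) (e : rel T) (x y : T) : connect e x y ->
  dist e x y = 0 -> x = y.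
Proof. by case/connect_geodesic=> -[|z p] [_ <-] // <-. Qed.

Lemma dist_eq1 (T : finType) (e : rel T) (x y : T) : connect e x y ->
  dist e x y = 1 -> e x y.
Proof.
by case/connect_geodesic=> -[|z [|t p]] [/= ep <-] <- //; rewrite andbT in ep.
Qed.

Lemma dist_triangle (T : finType) (e : rel T) (x y z : T) :
  connect e x y -> connect e y z -> dist e x z <= dist e x y + dist e y z.
Proof.
case/connect_geodesic=> p [ep lp] <- /connect_geodesic[q [eq lq] <-].
by rewrite -size_cat dist_le_path // ?cat_path ?last_cat lp ?ep.
Qed.

Lemma dist_sym_le (T : finType) (e : rel T) (x y : T) :
  symmetric e -> connect e x y -> dist e y x <= dist e x y.
Proof.
move=> se /connect_geodesic[p [ep <-] <-].
rewrite -(size_belast x p) -size_rev dist_le_path //.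
  by rewrite rev_path (eq_path (e' := e)) // => a b; rewrite /= se.
by case: (p) => //= a s; rewrite rev_cons last_rcons.
Qed.

Lemma dist_le_diam (T : finType) (e : rel T) (x y : T) : dist e x y <= diam e.
Proof.
by apply: leq_trans (leq_bigmax x); apply: (leq_bigmax (F := fun y => dist e x y)).
Qed.

(** * Convexity of the weight on a tree *)

Lemma tree_distC (T : finType) (e : rel T) (x y : T) :
  is_tree e -> dist e x y = dist e y x.
Proof. by case=> _ se _ ce _; apply/eqP; rewrite eqn_leq !dist_sym_le. Qed.

(* The walks that descend from [a] and [c] towards [v] avoid [b], so together
   with [b] they would enclose a cycle. *)
Lemma tree_neighbour_farther (T : finType) (e : rel T) (v a b c : T) :
  is_tree e -> e b a -> e b c -> a != c ->
  dist e a v <= dist e b v -> dist e b v < dist e c v.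
Proof.
move=> [_ se ie ce acyc] eba ebc neq_ac le_a; rewrite ltnNge; apply/negP => le_c.
pose e' := [rel x y | [&& e x y, x != b & y != b]].
have se' : symmetric e' by move=> x y /=; rewrite se andbA andbAC -andbA.
have down n x : dist e x v = n -> x != b -> n <= dist e b v -> connect e' x v.
  elim: n x => [|n IHn] x dx xb le_n; first by rewrite (dist_eq0 (ce x v) dx).
  have [[|y p] [/= ep lp] sp] := connect_geodesic (ce x v).
    by rewrite dx in sp.
  case/andP: ep => exy ep.
  have dyn : dist e y v <= n.
    by rewrite -ltnS -dx -sp ltnS dist_le_path.
  have dy : dist e y v = n.
    apply/eqP; rewrite eqn_leq dyn /= -ltnS -dx.
    by rewrite (leq_trans (dist_triangle (ce x y) (ce y v))) // -add1n leq_add2r dist_edge.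
  (* The vertex after [x] on a geodesic is strictly closer to [v] than [b] is, so the descent cannot
     run into [b]. *)
  have yb : y != b by apply: contraTneq le_n => <-; rewrite dy ltnn.
  apply: connect_trans (IHn y dy yb (ltnW le_n)).
  by apply: connect1; rewrite /= exy xb.
have neq_b z : e b z -> z != b by apply: contraTneq => ->; rewrite ie.
have /connectP[p0 ep0 cE] : connect e' a c.
  apply: connect_trans (down _ _ erefl (neq_b _ eba) le_a) _.
  by rewrite (sym_connect_sym se') (down _ _ erefl (neq_b _ ebc)).
move: cE; case/shortenP: ep0 => p ep up _ cE.
have ep_e : path e a p by apply: sub_path ep => x y /= /and3P[].
have b_notin : b \notin a :: p.
  rewrite inE negb_or eq_sym (neq_b _ eba) /=.
  elim: p (a) ep {up ep_e cE} => //= y p IHp x /andP[/and3P[_ _ yb] ep].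
  by rewrite inE negb_or eq_sym yb (IHp y).
(* The closed walk from [b] through [a] and [p] has [2 + size p] distinct vertices; acyclicity
   leaves only an empty [p], which would make [c] equal to [a]. *)
have := acyc [:: b, a & p]; rewrite /ucycle /ucycleb /= eba rcons_path ep_e -cE.
rewrite se ebc b_notin -/(uniq (a :: p)) up => /(_ isT).
by case: (p) cE => // cE; rewrite cE eqxx in neq_ac.
Qed.

(** For each [v], at least one of [a], [c] is farther from [v] than [b], and the other is at most
    one closer, so convexity holds term by term. The term [v = b] is strict, since it vanishes on
    the left only. *)
Lemma tree_weight_convex (T : finType) (e : rel T) (a b c : T) :
  is_tree e -> e a b -> e b c -> a != c ->
  (weight e b).*2 < weight e a + weight e c.
Proof.
move=> tree_e eab ebc neq_ac; have [_ se ie ce _] := tree_e.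
have eba : e b a by rewrite se.
have dC x y := tree_distC x y tree_e.
have convex v : (dist e v b).*2 <= dist e v a + dist e v c.
  have := dist_triangle (ce v a) (ce a b); have := dist_triangle (ce v c) (ce c b).
  have := dist_edge eab; have := dist_edge ebc; rewrite (dC b c).
  have := @tree_neighbour_farther _ _ v a b c tree_e eba ebc neq_ac.
  rewrite !(dC _ v); lia.
rewrite -muln2 /weight big_distrl -big_split /= (bigD1 b) // [ltnRHS](bigD1 b) //=.
rewrite distxx mul0n -addSn leq_add //; last first.
  by apply: leq_sum => v _; rewrite muln2.
rewrite addn_gt0 lt0n; apply/orP; left; apply/eqP => /(dist_eq0 (ce _ _)) ba.
by rewrite ba ie in eba.
Qed.

(** By strict convexity, once the weight does not drop along an edge of a path, it rises strictly
    along every later edge. *)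
Lemma tree_weight_path_increasing (T : finType) (e : rel T) (x y : T) (p : seq T) :
  is_tree e -> path e x (y :: p) -> uniq [:: x, y & p] ->
  weight e x <= weight e y -> p != [::] -> weight e y < weight e (last y p).
Proof.
move=> tree_e; elim: p x y => // z p IHp x y /= /and3P[exy eyz ep] /andP[].
rewrite !inE !negb_or => /and3P[_ xz _] uyz le_xy _.
have lt_yz : weight e y < weight e z.
  by have := tree_weight_convex tree_e exy eyz xz; lia.
have [->|p_neq0] := eqVneq p [::] => //.
apply: ltn_trans lt_yz (IHp y z _ _ (ltnW lt_yz) p_neq0); first by rewrite /= eyz.
by rewrite /= inE negb_or.
Qed.

(** * Weight centres and levels *)

Lemma weight_centresP (T : finType) (e : rel T) (x : T) :
  reflect (forall y, weight e x <= weight e y) (x \in weight_centres e).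
Proof. by rewrite inE; apply: forallP. Qed.

(** Leaving a centre, the weight cannot drop on the first edge; if the path had a second edge, its
    end would outweigh an earlier vertex and could not be a centre. *)
Lemma weight_centres_adjacent (T : finType) (e : rel T) (x y : T) :
  is_tree e -> x \in weight_centres e -> y \in weight_centres e -> x != y -> e x y.
Proof.
move=> tree_e /weight_centresP cx /weight_centresP cy.
have [_ _ _ ce _] := tree_e.
have /connectP[p0 ep0 yE] := ce x y; move: cy; rewrite {}yE.
case/shortenP: ep0 => -[|z p] ep up _ cy /=; first by rewrite eqxx.
have [->|p_neq0] := eqVneq p [::]; first by case/andP: ep.
have := tree_weight_path_increasing tree_e ep up (cx z) p_neq0.
by rewrite ltnNge cy.
Qed.

Lemma weight_centre_exists (T : finType) (e : rel T) :
  0 < #|T| -> exists x, x \in weight_centres e.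
Proof.
case/card_gt0P=> x0 _; exists [arg min_(x < x0) weight e x].
by apply/weight_centresP => y; case: arg_minnP => // x _; apply.
Qed.

(** Three centres would be pairwise adjacent and form a triangle. *)
Lemma card_weight_centres (T : finType) (e : rel T) :
  is_tree e -> #|weight_centres e| <= 2.
Proof.
move=> tree_e; have [_ _ _ _ acyc] := tree_e.
rewrite leqNgt; apply/negP => /card_gt2P[x [y [z [[Wx Wy Wz] [xy yz zx]]]]].
have adj := weight_centres_adjacent tree_e.
have := acyc [:: x; y; z]; rewrite /ucycle /ucycleb /= !adj // !inE.
by rewrite (negPf xy) (negPf yz) eq_sym (negPf zx) => /(_ isT).
Qed.

Lemma level_le_dist (T : finType) (e : rel T) (u x : T) :
  x \in weight_centres e -> level e u <= dist e u x.
Proof.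
move=> Wx; rewrite /level; elim: (index_enum T) (mem_index_enum x) => // y s IHs.
rewrite inE big_cons => /predU1P[<-|/IHs le_s]; first by rewrite Wx geq_minl.
by case: ifP => // _; apply: leq_trans (geq_minr _ _) le_s.
Qed.

Lemma level_attained (T : finType) (e : rel T) (u : T) : 0 < #|T| ->
  exists2 x, x \in weight_centres e & level e u = dist e u x.
Proof.
move=> T_gt0; have [x0 Wx0] := weight_centre_exists e T_gt0.
pose attained n := exists2 x, x \in weight_centres e & n = dist e u x.
have: level e u = #|T| \/ attained (level e u).
  rewrite /level; elim/big_ind: _ => [|m n|x Wx]; first by left.
    by rewrite /minn; case: ifP.
  by right; exists x.
(* If the minimum equals its default [#|T|], then any centre attains it, since no distance exceeds
   [#|T|]. *)
case=> // lev_max; exists x0 => //; apply/eqP.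
by rewrite eqn_leq level_le_dist //= lev_max dist_le_card.
Qed.

Lemma level_eq0 (T : finType) (e : rel T) (u : T) :
  is_tree e -> (level e u == 0) = (u \in weight_centres e).
Proof.
move=> [T_gt0 _ _ ce _]; apply/eqP/idP => [lev0|Wu]; last first.
  by apply/eqP; rewrite -leqn0 -(distxx e u) level_le_dist.
have [x Wx] := level_attained e u T_gt0.
by rewrite lev0 => /esym/(dist_eq0 (ce _ _))->.
Qed.

(** A walk from [u] to [v] through their nearest centres [x] and [y] costs the two levels plus
    [dist e x y]. That distance is 0 when [eps e] is 1, and at most 1 when [eps e] is 0. *)
Lemma dist_le_levels (T : finType) (e : rel T) (u v : T) :
  is_tree e -> dist e u v + eps e <= level e u + level e v + 1.
Proof.
move=> tree_e; have [T_gt0 _ _ ce _] := tree_e.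
have [x Wx ->] := level_attained e u T_gt0.
have [y Wy ->] := level_attained e v T_gt0; rewrite (tree_distC v y tree_e).
have := dist_triangle (ce u x) (ce x v); have := dist_triangle (ce x y) (ce y v).
suff: dist e x y + eps e <= 1 by lia.
rewrite /eps; case: (eqVneq #|_| 1) => [/eqP/cards1P[w W_w]|_].
  by move: Wx Wy; rewrite W_w !inE => /eqP-> /eqP->; rewrite distxx.
rewrite addn0; have [->|xy] := eqVneq x y; first by rewrite distxx.
by rewrite dist_edge // weight_centres_adjacent.
Qed.

Local Open Scope ring_scope.

(** * The label sequence of a vertex order *)

Lemma label_span_ge (T : finType) (f : T -> nat) (x y : T) :
  (f y)%:Z - (f x)%:Z <= (label_span f)%:Z.
Proof.
have: (`|((f x)%:Z - (f y)%:Z)%R| <= label_span f)%N.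
  apply: leq_trans (leq_bigmax x).
  by apply: (leq_bigmax (F := fun y => `|((f x)%:Z - (f y)%:Z)%R|%N)).
lia.
Qed.

Lemma label_seq0 (T : finType) (e : rel T) (u : nat -> T) : label_seq e u 0 = 0.
Proof. by []. Qed.

Lemma label_seq_diff (T : finType) (e : rel T) (u : nat -> T) (i j : nat) :
  (i <= j)%N ->
  label_seq e u j - label_seq e u i =
    (j%:Z - i%:Z) * ((diam e)%:Z + (eps e)%:Z)
    - \sum_(i <= t < j) ((level e (u t))%:Z + (level e (u t.+1))%:Z).
Proof.
move=> le_ij; rewrite -(subnKC le_ij); elim: (j - i)%N => [|k IHk].
  by rewrite addn0 big_geq //; lia.
rewrite addnS big_nat_recr ?leq_addr //=.
set S := \sum_(i <= t < _) _ in IHk *; set D := (diam e)%:Z + _ in IHk *.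
have -> : (i + k).+1%:Z - i%:Z = ((i + k)%N%:Z - i%:Z) + 1 by lia.
by rewrite mulrDl mul1r; lia.
Qed.

(** Telescoping turns condition (b) into the radio condition for the labels [label_seq e u], with
    the difference taken without absolute value. *)
Lemma distance_condE (T : finType) (e : rel T) (u : nat -> T) :
  distance_cond e u <->
  forall i j, (i < j)%N -> (j < #|T|)%N ->
    (diam e)%:Z + 1 <= (dist e (u i) (u j))%:Z + (label_seq e u j - label_seq e u i).
Proof.
by split=> du i j lt_ij lt_j; have := du i j lt_ij lt_j;
  rewrite (label_seq_diff _ _ (ltnW lt_ij)); lia.
Qed.

Lemma sum_vertex_order (T : finType) (u : nat -> T) (F : T -> int) :
  vertex_order u -> \sum_(0 <= i < #|T|) F (u i) = \sum_(x : T) F x.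
Proof.
case=> inj_u surj_u; rewrite big_mkord.
have inj_uo : injective (fun i : 'I_#|T| => u i).
  by move=> i j /inj_u ij; apply/val_inj/ij.
have bij_u : bijective (fun i : 'I_#|T| => u i).
  by apply: inj_card_bij; rewrite ?card_ord.
by rewrite (reindex (fun i : 'I_#|T| => u i)) //; apply: onW_bij.
Qed.

(** In the sum over consecutive pairs each vertex is counted twice, except that the first and the
    last one are counted once; this leaves their two levels as a correction. *)
Lemma label_seq_last (T : finType) (e : rel T) (u : nat -> T) :
  (0 < #|T|)%N -> vertex_order u ->
  label_seq e u #|T|.-1 =
    (#|T|%:Z - 1) * ((diam e)%:Z + (eps e)%:Z) - 2 * (total_level e)%:Z
    + (level e (u 0%N))%:Z + (level e (u #|T|.-1))%:Z.
Proof.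
move=> T_gt0 ord_u; have := label_seq_diff e u (leq0n #|T|.-1).
rewrite big_split /= !subr0 => ->.
have := sum_vertex_order (fun x => (level e x)%:Z) ord_u.
have -> : \sum_x (level e x)%:Z = (total_level e)%:Z.
  by rewrite /total_level -natz natr_sum; apply: eq_bigr => x _; rewrite natz.
move=> sumL; have := sumL; have := sumL.
(* The total level is split twice, without its last term and without its first, to match the two
   sums of the telescoped formula. *)
rewrite -{1}(prednK T_gt0) big_nat_recr //= => sum1.
rewrite -{1}(prednK T_gt0) big_nat_recl //= => sum2.
have -> : #|T|.-1%:Z = #|T|%:Z - 1 by lia.
move: (_ * (_ + _)) (\sum_(0 <= i < _) _) (\sum_(0 <= i < _) _) sum1 sum2; lia.
Qed.

(** * The lower bound for the span *)

Lemma level_ends_ge_eps (T : finType) (e : rel T) (x y : T) :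
  is_tree e -> x != y -> (eps e <= level e x + level e y)%N.
Proof.
move=> tree_e xy; rewrite /eps; case: (eqVneq #|_| 1%N) => // /eqP/cards1P[w W_w].
rewrite lt0n addn_eq0 !level_eq0 // W_w !inE.
by apply: contra xy => /andP[/eqP-> /eqP->].
Qed.

Lemma monotone_vertex_order (T : finType) (f : T -> nat) :
  (0 < #|T|)%N -> exists2 u : nat -> T, vertex_order u &
    forall i j, (i <= j)%N -> (j < #|T|)%N -> (f (u i) <= f (u j))%N.
Proof.
case/card_gt0P=> x0 _; pose s := sort (relpre f leq) (enum T).
have sz_s : size s = #|T| by rewrite size_sort -cardE.
have tot : total (relpre f leq) by move=> x y; apply: leq_total.
have us : uniq s by rewrite sort_uniq enum_uniq.
exists (nth x0 s) => [|i j le_ij lt_j].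
  split=> [i j lti ltj /eqP|x].
    by rewrite nth_uniq ?sz_s // => /eqP.
  have xs : x \in s by rewrite mem_sort mem_enum.
  by exists (index x s); rewrite ?nth_index // -sz_s index_mem.
apply: (@sorted_leq_nth _ (relpre f leq)) => //; rewrite ?inE ?sz_s //.
- by move=> x y z /=; apply: leq_trans.
- by move=> x /=.
- exact: sort_sorted.
- exact: leq_ltn_trans lt_j.
Qed.

(** Each single increment suffices: the radio condition for two consecutive vertices, combined with
    [dist_le_levels], bounds it below by the increment of [label_seq]. *)
Lemma radio_labeling_ge_label_seq (T : finType) (e : rel T) (f : T -> nat)
    (u : nat -> T) (i j : nat) :
  is_tree e -> radio_labeling e f -> vertex_order u ->
  (forall i j, (i <= j)%N -> (j < #|T|)%N -> (f (u i) <= f (u j))%N) ->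
  (i <= j)%N -> (j < #|T|)%N ->
  label_seq e u j - label_seq e u i <= (f (u j))%:Z - (f (u i))%:Z.
Proof.
move=> tree_e rf [inj_u _] mono_f le_ij; rewrite -(subnKC le_ij).
elim: (j - i)%N => [|k IHk]; first by rewrite addn0 !subrr.
rewrite addnS => lt_k; have := IHk (ltnW lt_k) => {}IHk /=.
have /rf : u (i + k)%N != u (i + k).+1.
  by apply/eqP => /inj_u eq_k; have := eq_k (ltnW lt_k) lt_k; lia.
have := dist_le_levels (u (i + k)%N) (u (i + k).+1) tree_e.
have := mono_f _ _ (leqnSn (i + k)) lt_k.
lia.
Qed.

Lemma vertex_order_ends (T : finType) (u : nat -> T) :
  (1 < #|T|)%N -> vertex_order u -> u 0%N != u #|T|.-1.
Proof. by move=> T_gt1 [inj_u _]; apply/eqP => /inj_u; lia. Qed.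

Lemma diam_card_gt1 (T : finType) (e : rel T) : (0 < diam e)%N -> (1 < #|T|)%N.
Proof.
move=> d_gt0; rewrite ltnNge; apply: contraL d_gt0 => /card_le1_eqP T1.
rewrite -leqNgt; apply/bigmax_leqP => x _; apply/bigmax_leqP => y _.
by rewrite (T1 x y) // distxx.
Qed.

Lemma label_span_ge_bound (T : finType) (e : rel T) (f : T -> nat) :
  is_tree e -> (1 < #|T|)%N -> radio_labeling e f ->
  (#|T|%:Z - 1) * ((diam e)%:Z + (eps e)%:Z) - 2 * (total_level e)%:Z + (eps e)%:Z
    <= (label_span f)%:Z.
Proof.
move=> tree_e T_gt1 rf; have T_gt0 := ltnW T_gt1.
have [u ord_u mono_f] := monotone_vertex_order f T_gt0.
have lt_last : (#|T|.-1 < #|T|)%N by rewrite prednK.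
have := radio_labeling_ge_label_seq tree_e rf ord_u mono_f (leq0n _) lt_last.
rewrite label_seq_last // label_seq0 subr0.
have := level_ends_ge_eps tree_e (vertex_order_ends T_gt1 ord_u).
have := label_span_ge f (u 0%N) (u #|T|.-1).
lia.
Qed.

(** * The equality case and the labeling attached to an order *)

Lemma tight_labeling_order (T : finType) (e : rel T) (f : T -> nat) (u : nat -> T) :
  is_tree e -> (1 < #|T|)%N -> radio_labeling e f -> vertex_order u ->
  (forall i j, (i <= j)%N -> (j < #|T|)%N -> (f (u i) <= f (u j))%N) ->
  (label_span f)%:Z = (#|T|%:Z - 1) * ((diam e)%:Z + (eps e)%:Z)
                      - 2 * (total_level e)%:Z + (eps e)%:Z ->
  distance_cond e u /\ (level e (u 0%N) + level e (u #|T|.-1))%N = eps e.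
Proof.
move=> tree_e T_gt1 rf ord_u mono_f span_f; have T_gt0 := ltnW T_gt1.
have lt_last : (#|T|.-1 < #|T|)%N by rewrite prednK.
have ge_seq i j := @radio_labeling_ge_label_seq _ _ f u i j tree_e rf ord_u mono_f.
have ge_eps := level_ends_ge_eps tree_e (vertex_order_ends T_gt1 ord_u).
have le_span := label_span_ge f (u 0%N) (u #|T|.-1).
have last_u := label_seq_last e T_gt0 ord_u.
have ge_last := ge_seq _ _ (leq0n _) lt_last; rewrite label_seq0 subr0 in ge_last.
(* The estimates from 0 to [i] and from [i] to the last index add up to one that holds with
   equality, so both are equalities. *)
have seqE i : (i < #|T|)%N -> (f (u i))%:Z - (f (u 0%N))%:Z = label_seq e u i.
  move=> lt_i; have := ge_seq 0%N i (leq0n i) lt_i; rewrite label_seq0 subr0.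
  have le_i : (i <= #|T|.-1)%N by rewrite -ltnS prednK.
  by have := ge_seq i _ le_i lt_last; lia.
split; last by lia.
apply/distance_condE => i j lt_ij lt_j; have lt_i := ltn_trans lt_ij lt_j.
have uij : u i != u j by apply/eqP => /(proj1 ord_u); lia.
have := rf _ _ uij; have := mono_f _ _ (ltnW lt_ij) lt_j.
by rewrite -!seqE //; lia.
Qed.

(** With a single centre the level is the distance to it, so level 1 characterizes its neighbours.
    With two centres [eps e] is 0, and both ends must be centres. *)
Lemma endpoints_condP (T : finType) (e : rel T) (u : nat -> T) :
  is_tree e -> (1 < #|T|)%N -> vertex_order u ->
  (endpoints_cond e u <->
   level e (u 0%N) = 0%N /\ level e (u #|T|.-1) = eps e).
Proof.
move=> tree_e T_gt1 ord_u; have [T_gt0 _ ie ce _] := tree_e.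
have neq_ends := vertex_order_ends T_gt1 ord_u.
have [W1|W_neq1] := eqVneq #|weight_centres e| 1%N.
  have eps1 : eps e = 1%N by rewrite /eps W1 eqxx.
  have /eqP/cards1P[w W_w] := W1; rewrite eps1.
  have lev x : level e x = dist e x w.
    have [y] := level_attained e x T_gt0.
    by rewrite W_w inE => /eqP->.
  split=> [[/(_ w W_w) [-> ew] _]|[]].
    rewrite !lev distxx; split=> //; apply/eqP; rewrite eqn_leq.
    rewrite (tree_distC _ _ tree_e) dist_edge // lt0n; apply: contraTneq ew.
    by move/(dist_eq0 (ce _ _)) => <-; rewrite ie.
  rewrite !lev => /(dist_eq0 (ce _ _)) u0 ul; split=> [v|v v' vv'].
    rewrite W_w => /set1_inj <-; split=> //; apply: (dist_eq1 (ce _ _)).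
    by rewrite tree_distC.
  by move=> W2; move: W1; rewrite W2 cards2 vv'.
have eps0 : eps e = 0%N by rewrite /eps (negPf W_neq1).
have W2 : #|weight_centres e| = 2%N.
  have [x Wx] := weight_centre_exists e T_gt0.
  have : (0 < #|weight_centres e|)%N by apply/card_gt0P; exists x.
  by have := card_weight_centres tree_e; lia.
rewrite eps0; split=> [[_ end2]|[/eqP lev0 /eqP levl]].
  have /eqP/cards2P[w [w' [ww' W_ww']]] := W2.
  have ends := end2 _ _ ww' W_ww'; rewrite -W_ww' in ends.
  split; apply/eqP; rewrite level_eq0 // -ends !inE eqxx ?orbT //.
split=> [w W_w|w w' ww' <-]; first by rewrite W_w cards1 in W2.
(* The two ends are distinct centres, so they exhaust a set of two elements. *)
apply/eqP; rewrite eqEcard cards2 neq_ends W2 leqnn andbT subUset !sub1set.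
by rewrite -!level_eq0 // lev0.
Qed.

Lemma order_labeling_optimal (T : finType) (e : rel T) (u : nat -> T) :
  is_tree e -> (1 < #|T|)%N ->
  vertex_order u -> endpoints_cond e u -> distance_cond e u ->
  exists f : T -> nat,
    [/\ forall i : nat, (i < #|T|)%N -> (f (u i))%:Z = label_seq e u i,
        radio_labeling e f
      & (label_span f)%:Z = (#|T|%:Z - 1) * ((diam e)%:Z + (eps e)%:Z)
                            - 2 * (total_level e)%:Z + (eps e)%:Z].
Proof.
move=> tree_e T_gt1 ord_u end_u /distance_condE dist_u; have T_gt0 := ltnW T_gt1.
have [lev0 levl] := (endpoints_condP tree_e T_gt1 ord_u).1 end_u.
(* No distance exceeds the diameter, so condition (b) leaves a label difference of at least 1. *)
have lt_seq i j : (i < j)%N -> (j < #|T|)%N -> label_seq e u i < label_seq e u j.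
  by move=> lt_ij lt_j; have := dist_u i j lt_ij lt_j;
    have := dist_le_diam e (u i) (u j); lia.
have le_seq i j : (i <= j)%N -> (j < #|T|)%N -> label_seq e u i <= label_seq e u j.
  by rewrite leq_eqVlt => /predU1P[->//|lt_ij] lt_j; apply/ltW/lt_seq.
have [inj_u surj_u] := ord_u.
(* [r] sends a vertex to its position in the order, which transports [label_seq] to a labeling of
   vertices. *)
have /choice[r rP] x : exists i, (i < #|T|)%N /\ u i = x.
  by have [i] := surj_u x; exists i.
have rK i : (i < #|T|)%N -> r (u i) = i.
  by move=> lt_i; have [lt_r /inj_u->] := rP (u i).
pose f x := absz (label_seq e u (r x)).
have fE x : (f x)%:Z = label_seq e u (r x).
  by rewrite /f gez0_abs //; have [lt_r _] := rP x; apply: (le_seq 0%N).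
have span_last : (label_span f)%:Z = label_seq e u #|T|.-1.
  have lt_last : (#|T|.-1 < #|T|)%N by rewrite prednK.
  have := label_span_ge f (u 0%N) (u #|T|.-1); rewrite !fE !rK // label_seq0 subr0 => ge_l.
  apply/eqP; rewrite eq_le ge_l andbT.
  have ge0 := le_seq 0%N _ (leq0n _) lt_last; rewrite label_seq0 in ge0.
  rewrite -(gez0_abs ge0) lez_nat; apply/bigmax_leqP => x _; apply/bigmax_leqP => y _.
  rewrite !fE; have [[ltx _] [lty _]] := (rP x, rP y).
  have := le_seq 0%N _ (leq0n _) ltx; have := le_seq 0%N _ (leq0n _) lty; rewrite label_seq0.
  have le_r z : (r z < #|T|)%N -> (r z <= #|T|.-1)%N by lia.
  have := le_seq _ _ (le_r _ ltx) lt_last; have := le_seq _ _ (le_r _ lty) lt_last.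
  lia.
exists f; split=> [i lt_i|x y|]; first by rewrite fE rK.
  have [[ltx xE] [lty yE]] := (rP x, rP y) => xy; rewrite !fE.
  have [ltr|ltr|eqr] := ltngtP (r x) (r y).
  - by have := dist_u _ _ ltr lty; rewrite xE yE; lia.
  - by have := dist_u _ _ ltr ltx; rewrite xE yE (tree_distC y x) //; lia.
  - by rewrite -xE -yE eqr eqxx in xy.
by rewrite span_last label_seq_last // lev0 levl addr0.
Qed.

(** * The radio number and the characterization *)

Lemma rn_le (T : finType) (e : rel T) (f : T -> nat) :
  radio_labeling e f -> (rn e <= label_span f)%N.
Proof.
by move=> rf; rewrite /rn; case: ex_minnP => n _; apply; apply/asboolP; exists f.
Qed.

Lemma rn_attained (T : finType) (e : rel T) :
  exists2 f : T -> nat, radio_labeling e f & label_span f = rn e.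
Proof. by rewrite /rn; case: ex_minnP => n /asboolP. Qed.

Theorem theorem3p2 (T : finType) (e : rel T)
    (tree_e : is_tree e) (diam_ge2 : (2 <= diam e)%N) :
  ((rn e)%:Z = (#|T|%:Z - 1) * ((diam e)%:Z + (eps e)%:Z)
               - 2 * (total_level e)%:Z + (eps e)%:Z
   <-> exists u : nat -> T,
         [/\ vertex_order u, endpoints_cond e u & distance_cond e u]) /\
  (forall u : nat -> T,
     vertex_order u -> endpoints_cond e u -> distance_cond e u ->
     exists f : T -> nat,
       (forall i : nat, (i < #|T|)%N -> (f (u i))%:Z = label_seq e u i) /\
       optimal_radio_labeling e f).
Proof.
have T_gt1 := diam_card_gt1 (ltnW diam_ge2); have T_gt0 := ltnW T_gt1.
have [f rf span_f] := rn_attained e.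
have rn_ge := label_span_ge_bound tree_e T_gt1 rf; rewrite span_f in rn_ge.
have rn_order u : vertex_order u -> endpoints_cond e u -> distance_cond e u ->
    exists2 g : T -> nat,
      (forall i : nat, (i < #|T|)%N -> (g (u i))%:Z = label_seq e u i) /\
      optimal_radio_labeling e g
    & (rn e)%:Z = (#|T|%:Z - 1) * ((diam e)%:Z + (eps e)%:Z)
                  - 2 * (total_level e)%:Z + (eps e)%:Z.
  move=> ord_u end_u dist_u.
  have [g [gE rg span_g]] := order_labeling_optimal tree_e T_gt1 ord_u end_u dist_u.
  (* The span of [g] equals the lower bound [rn_ge] for [rn e], and minimality of [rn e] gives the
     other inequality. *)
  have rn_eq : label_span g = rn e by have := rn_le rg; lia.
  by exists g; rewrite -?rn_eq.
split; last by move=> u ord_u end_u dist_u; have [g] := rn_order u ord_u end_u dist_u; exists g.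
split=> [rnE|[u [ord_u end_u dist_u]]]; last by have [] := rn_order u ord_u end_u dist_u.
(* Sorting the vertices by a labeling of minimum span gives the required order, up to reversal. *)
have [u ord_u mono_f] := monotone_vertex_order f T_gt0.
rewrite -span_f in rnE.
have [dist_u ends_u] := tight_labeling_order tree_e T_gt1 rf ord_u mono_f rnE.
(* Tightness determines only the sum of the two end levels, whereas (a) also asks for a centre in
   first position. *)
have [lev0|lev_neq0] := eqVneq (level e (u 0%N)) 0%N.
  exists u; split=> //; apply/endpoints_condP => //.
  by rewrite -ends_u lev0.
(* Otherwise the centre comes last, and the reflected labeling puts it first. *)
pose M := (\max_x f x)%N; have f_le x : (f x <= M)%N by apply: leq_bigmax.
pose g x := (M - f x)%N.
have gE x y : `|(g x)%:Z - (g y)%:Z|%N = `|(f x)%:Z - (f y)%:Z|%N.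
  by rewrite /g; have := f_le x; have := f_le y; lia.
have rg : radio_labeling e g by move=> x y xy; rewrite gE; apply: rf.
have span_g : label_span g = label_span f.
  by apply: eq_bigr => x _; apply: eq_bigr => y _; apply: gE.
pose v i := u (#|T|.-1 - i)%N.
have ord_v : vertex_order v.
  have [inj_u surj_u] := ord_u; split=> [i j lti ltj /inj_u|x]; first by lia.
  by have [i lti <-] := surj_u x; exists (#|T|.-1 - i)%N; rewrite /v; [lia|congr u; lia].
have mono_g i j : (i <= j)%N -> (j < #|T|)%N -> (g (v i) <= g (v j))%N.
  by move=> le_ij lt_j; rewrite leq_sub2l // mono_f; lia.
rewrite -span_g in rnE.
have [dist_v ends_v] := tight_labeling_order tree_e T_gt1 rg ord_v mono_g rnE.
exists v; split=> //; apply/endpoints_condP => //.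
have eps_le1 : (eps e <= 1)%N by rewrite /eps leq_b1.
(* The end levels of [u] sum to at most 1 and the first is nonzero, so the last is 0; it is the
   first one of [v]. *)
by move: ends_u ends_v lev_neq0; rewrite /v subn0 subnn; lia.
Qed.
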